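(* Let $G$ be a finite simple connected graph with $n$ vertices and $m$ edges, let $A(G)\subset V(G)\times V(G)$ be a set of arcs with $A(G)\cup A(G)^{-1}=D(G)$, and let $\theta: D(G)\to\mathbb{C}$ satisfy $\theta(e^{-1})=-\theta(e)$ for every $e\in A(G)$ and $\theta(e)=0$ for every $e\in A(G)\cap A(G)^{-1}$. Then, as formal power series in $u$, \[ {\bf Z}_\theta(u)=\prod_{[C]}\big(1-w(C)u^{|C|}\big)^{-1}=\exp\Big(\sum_{k=1}^\infty\frac{N_k}{k}u^k\Big), \] where $[C]$ runs over all equivalence classes of prime cycles of $G$ and $N_k=\sum\{w(C): C \text{ a cycle of length } k \text{ in } G\}$.
   Context: $D(G)=\{(u,v),(v,u): uv\in E(G)\}$ is the set of $2m$ arcs of $G$; for $e=(u,v)$, $o(e)=u$, $t(e)=v$, $e^{-1}=(v,u)$, and $A(G)^{-1}=\{e^{-1}:e\in A(G)\}$. The twisted Grover matrix ${\bf U}_\theta$ is the $2m\times2m$ matrix indexed by $D(G)$ with $(e,f)$-entry $2e^{-i\theta(e)}/\deg t(f)$ if $t(f)=o(e)$ and $f\ne e^{-1}$; $e^{-i\theta(e)}(2/\deg t(f)-1)$ if $f=e^{-1}$; $0$ otherwise. ${\bf Z}_\theta(u)^{-1}=\det({\bf I}_{2m}-u{\bf U}_\theta)$. Weight: $w(e,f)=2e^{-i\theta(f)}/\deg t(e)$ if $t(e)=o(f)$ and $f\ne e^{-1}$; $w(e,f)=e^{-i\theta(f)}(2/\deg t(e)-1)$ if $f=e^{-1}$;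 $w(e,f)=0$ otherwise. A cycle of length $r$ is a sequence $C=(e_1,\ldots,e_r)$ of arcs with $t(e_i)=o(e_{i+1})$ for $1\le i\le r-1$ and $t(e_r)=o(e_1)$ (backtracking allowed); $|C|=r$ and $w(C)=w(e_1,e_2)\cdots w(e_{r-1},e_r)w(e_r,e_1)$. Two cycles are equivalent if one is a cyclic shift of the other. $C^l$ denotes the cycle going $l$ times around $C$; a cycle is prime if it is not of the form $B^l$ with $l\ge2$ for a cycle $B$. *)

(* Defs.v *)
From HB Require Import structures.
From mathcomp Require Import all_boot all_order all_algebra.
From mathcomp Require Import generic_quotient finmap boolp reals.
From mathcomp Require Import sequences exp trigo.
From mathcomp.real_closed Require Import complex.

Set Implicit Arguments.
Unset Strict Implicit.
Unset Printing Implicit Defensive.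

Import GRing.Theory.
Local Open Scope ring_scope.

Record fps (F : Type) := Fps { fps_coef : nat -> F }.

Lemma fpsP (F : Type) (f g : fps F) :
  (forall n, fps_coef f n = fps_coef g n) -> f = g.
Proof. by case: f g => [f] [g] /= fg; congr Fps; apply/funext. Qed.

HB.instance Definition _ (F : Type) := gen_eqMixin (fps F).
HB.instance Definition _ (F : Type) := gen_choiceMixin (fps F).

Section FpsRing.
Variable F : fieldType.
Implicit Types f g h : fps F.

Definition fps_zero : fps F := Fps (fun _ => 0).
Definition fps_opp f : fps F := Fps (fun n => - fps_coef f n).
Definition fps_add f g : fps F := Fps (fun n => fps_coef f n + fps_coef g n).

Lemma fps_addA : associative fps_add.
Proof. by move=> f g h; apply: fpsP => n /=; rewrite addrA. Qed.
Lemma fps_addC : commutative fps_add.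
Proof. by move=> f g; apply: fpsP => n /=; rewrite addrC. Qed.
Lemma fps_add0 : left_id fps_zero fps_add.
Proof. by move=> f; apply: fpsP => n /=; rewrite add0r. Qed.
Lemma fps_addN : left_inverse fps_zero fps_opp fps_add.
Proof. by move=> f; apply: fpsP => n /=; rewrite addNr. Qed.

HB.instance Definition _ := GRing.isZmodule.Build (fps F)
  fps_addA fps_addC fps_add0 fps_addN.

Definition fpsC (a : F) : fps F := Fps (fun n => if n == 0%N then a else 0).
Definition fpsX : fps F := Fps (fun n => (n == 1%N)%:R).

Definition fps_mul f g : fps F :=
  Fps (fun n => \sum_(i < n.+1) fps_coef f i * fps_coef g (n - i)).

Definition fps_trunc n f : {poly F} := \poly_(i < n.+1) fps_coef f i.

Lemma fps_truncE n f i : (i <= n)%N -> (fps_trunc n f)`_i = fps_coef f i.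
Proof. by move=> le_in; rewrite coef_poly ltnS le_in. Qed.

Lemma fps_mul_trunc n f g i : (i <= n)%N ->
  fps_coef (fps_mul f g) i = (fps_trunc n f * fps_trunc n g)`_i.
Proof.
move=> le_in; rewrite coefM; apply: eq_bigr => j _.
rewrite !fps_truncE //; first exact: leq_trans (leq_subr _ _) le_in.
by apply: leq_trans le_in; rewrite -ltnS.
Qed.

Lemma fps_mulC : commutative fps_mul.
Proof.
by move=> f g; apply: fpsP => n; rewrite !(fps_mul_trunc _ _ (leqnn n)) mulrC.
Qed.

Lemma fps_mulA : associative fps_mul.
Proof.
move=> f g h; apply: fpsP => n; rewrite !(fps_mul_trunc _ _ (leqnn n)).
have congl (p q r : {poly F}) : (forall i, (i <= n)%N -> p`_i = q`_i) ->
    (p * r)`_n = (q * r)`_n.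
  by move=> pq; rewrite !coefM; apply: eq_bigr => i _; rewrite pq // -ltnS.
rewrite mulrC (congl (fps_trunc n (fps_mul g h))
  (fps_trunc n g * fps_trunc n h)); last first.
  by move=> i le_in; rewrite fps_truncE // (fps_mul_trunc _ _ le_in).
rewrite mulrC mulrA; apply/esym/congl => i le_in.
by rewrite fps_truncE // (fps_mul_trunc _ _ le_in).
Qed.

Lemma fps_mul1 : left_id (fpsC 1) fps_mul.
Proof.
move=> f; apply: fpsP => n /=; rewrite big_ord_recl /= mul1r subn0.
rewrite big1 ?addr0//; by move=> i _; rewrite mul0r.
Qed.

Lemma fps_mulDl : left_distributive fps_mul fps_add.
Proof.
move=> f g h; apply: fpsP => n /=; rewrite -big_split /=.
by apply: eq_bigr => i _; rewrite mulrDl.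
Qed.

Lemma fps_1_neq0 : fpsC 1 != 0.
Proof.
by apply/eqP => /(congr1 (fun f => fps_coef f 0)) /= /eqP; rewrite oner_eq0.
Qed.

HB.instance Definition _ := GRing.Zmodule_isComNzRing.Build (fps F)
  fps_mulA fps_mulC fps_mul1 fps_mulDl fps_1_neq0.

Lemma fps_coef0 n : fps_coef (0 : fps F) n = 0. Proof. by []. Qed.
Lemma fps_coef1 n : fps_coef (1 : fps F) n = (n == 0%N)%:R.
Proof. by case: n. Qed.
Lemma fps_coefC a n : fps_coef (fpsC a) n = if n == 0%N then a else 0.
Proof. by []. Qed.
Lemma fps_coefX n : fps_coef fpsX n = (n == 1%N)%:R. Proof. by []. Qed.
Lemma fps_coefN f n : fps_coef (- f) n = - fps_coef f n. Proof. by []. Qed.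
Lemma fps_coefD f g n : fps_coef (f + g) n = fps_coef f n + fps_coef g n.
Proof. by []. Qed.
Lemma fps_coefM f g n :
  fps_coef (f * g) n = \sum_(i < n.+1) fps_coef f i * fps_coef g (n - i).
Proof. by []. Qed.
Lemma fps_coef_sum (I : Type) (r : seq I) (P : pred I) (E : I -> fps F) n :
  fps_coef (\sum_(i <- r | P i) E i) n = \sum_(i <- r | P i) fps_coef (E i) n.
Proof. by elim/big_rec2: _ => // i x y _ <-. Qed.
Lemma fps_coefCM a f n : fps_coef (fpsC a * f) n = a * fps_coef f n.
Proof.
rewrite fps_coefM big_ord_recl subn0 big1 ?addr0// => i _.
by rewrite mul0r.
Qed.

Lemma fps_coefX_small h j n : fps_coef h 0 = 0 -> (n < j)%N ->
  fps_coef (h ^+ j) n = 0.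
Proof.
move=> h0; elim: j n => // j IHj n ltnj; rewrite exprS fps_coefM big1 // => i _.
have [->|i_gt0] := posnP i; first by rewrite h0 mul0r.
rewrite IHj ?mulr0//; apply: (@leq_trans n) => //.
by rewrite ltn_subrL i_gt0 (leq_trans i_gt0) // -ltnS.
Qed.

(* 1/f = f_0^-1 * \sum_j (1 - f/f_0)^j for f_0 != 0; the terms with j > n do
   not contribute to the coefficient of u^n. *)
Definition fps_unit : pred (fps F) := fun f => fps_coef f 0 != 0.
Definition fps_inv f : fps F :=
  if fps_unit f then
    let a := (fps_coef f 0)^-1 in
    Fps (fun n => a * \sum_(j < n.+1) fps_coef ((1 - fpsC a * f) ^+ j) n)
  else f.

Lemma fps_mulVx : {in fps_unit, left_inverse 1 fps_inv *%R}.
Proof.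
move=> f f0; rewrite /fps_inv (f0 : fps_unit f) mulrC.
set a := _^-1; set h := 1 - fpsC a * f; set S := Fps _.
have h0 : fps_coef h 0 = 0.
  by rewrite fps_coefD fps_coefN fps_coefCM fps_coef1 /= mulVf ?subrr.
apply: fpsP => n.
have -> : fps_coef (f * S) n =
    fps_coef ((fpsC a * f) * \sum_(j < n.+1) h ^+ j) n.
  rewrite [fpsC a * f]mulrC -mulrA !fps_coefM; apply: eq_bigr => i _.
  rewrite fps_coefCM fps_coef_sum /=; congr (_ * (_ * _)).
  rewrite (big_ord_widen n.+1 (fun j => fps_coef (h ^+ j) (n - i))); last first.
    by rewrite ltnS leq_subr.
  rewrite big_mkcond /=; apply: eq_bigr => j _.
  by case: ltnP => // ?; rewrite fps_coefX_small.
have -> : fpsC a * f = 1 - h by rewrite /h opprB addrC subrK.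
rewrite -[1 - h]opprB mulNr -subrX1 opprB fps_coefD fps_coefN.
by rewrite fps_coefX_small ?subr0.
Qed.

Lemma fps_unitPl f g : g * f = 1 -> fps_unit f.
Proof.
move=> /(congr1 (fun f => fps_coef f 0)); rewrite fps_coefM big_ord1 /= => gf.
by apply/eqP => f0; move/eqP: gf; rewrite f0 mulr0 eq_sym oner_eq0.
Qed.

Lemma fps_inv_out : {in [predC fps_unit], fps_inv =1 id}.
Proof.
by move=> f; rewrite inE /fps_inv => /negbTE; rewrite /in_mem /= => ->.
Qed.

HB.instance Definition _ := GRing.ComNzRing_hasMulInverse.Build (fps F)
  fps_mulVx fps_unitPl fps_inv_out.

(* exp f = \sum_j f^j / j!, for f without constant term (for other f the
   value is meaningless); the terms with j > n do not contribute to the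
   coefficient of u^n. *)
Definition fps_exp f : fps F :=
  Fps (fun n => \sum_(j < n.+1) fps_coef (f ^+ j) n / (j`!)%:R).

(* P is the formal product of the family E: every coefficient of the finite
   partial products is eventually equal to that of P, along the finite subsets
   of I ordered by inclusion. *)
Definition fps_is_prod (I : choiceType) (E : I -> fps F) (P : fps F) : Prop :=
  forall n, exists S0 : {fset I}, forall S : {fset I}, (S0 `<=` S)%fset ->
    fps_coef (\prod_(i <- S) E i) n = fps_coef P n.

End FpsRing.

Arguments fpsX {F}.

Definition cexp (R : realType) (z : R[i]) : R[i] :=
  let: (x +i* y)%C := z in (expR x * cos y +i* (expR x * sin y))%C.

Record sgraph := SGraph {
  vertex :> finType;
  adj : rel vertex;
  adj_sym : symmetric adj;
  adj_irr : irreflexive adj }.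

Definition connected_graph (G : sgraph) : Prop :=
  (0 < #|G|)%N /\ forall x y : G, connect (@adj G) x y.

Definition arcs (G : sgraph) : {set G * G} := [set p | adj p.1 p.2].

Definition rev_arcs (G : sgraph) (A : {set G * G}) : {set G * G} :=
  [set (p.2, p.1) | p in A].

Definition degree (G : sgraph) (x : G) : nat := #|[set y | adj x y]|.

Section Arcs.
Variable G : sgraph.

(* The set D(G) as a type; its cardinal is 2m. *)
Definition darc := {p : G * G | p \in arcs G}.

Definition org (e : darc) : G := (val e).1.
Definition tgt (e : darc) : G := (val e).2.

Lemma inv_arc_subproof (e : darc) : (tgt e, org e) \in arcs G.
Proof. by have := valP e; rewrite !inE adj_sym. Qed.
Definition inv_arc (e : darc) : darc :=
  exist _ (tgt e, org e) (inv_arc_subproof e).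

Definition is_cycle (C : seq darc) : bool :=
  (C != [::]) && path.cycle (fun e f => tgt e == org f) C.

Definition cycle_pow (C : seq darc) (l : nat) : seq darc := flatten (nseq l C).

Definition prime_cycle (C : seq darc) : Prop :=
  is_cycle C /\
  ~ exists B l, [/\ is_cycle B, (2 <= l)%N & C = cycle_pow B l].

Definition primeCycle := {C : seq darc | `[< prime_cycle C >]}.

(* rot i C is C itself for i >= size C. *)
Definition cycle_equiv (C C' : primeCycle) : bool :=
  `[< exists i, val C' = rot i (val C) >].

Lemma cycle_equiv_refl : reflexive cycle_equiv.
Proof. by move=> C; apply/asboolP; exists 0%N; rewrite rot0. Qed.

Lemma cycle_equiv_sym : symmetric cycle_equiv.
Proof.
suff imp C C' : cycle_equiv C C' -> cycle_equiv C' C.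
  by move=> C C'; apply/idP/idP; apply: imp.
case/asboolP=> i eqC'; apply/asboolP; exists (size (val C') - i)%N.
by rewrite -/(rotr i (val C')) eqC' rotK.
Qed.

Lemma cycle_equiv_trans : transitive cycle_equiv.
Proof.
move=> C2 C1 C3 /asboolP[i eq2] /asboolP[j eq3]; apply/asboolP.
by exists (rot_add (val C1) i j); rewrite eq3 eq2 rot_rot_add.
Qed.

Canonical cycle_equiv_rel :=
  EquivRel cycle_equiv cycle_equiv_refl cycle_equiv_sym cycle_equiv_trans.

Definition primeClass := {eq_quot cycle_equiv_rel}%qT.

Definition class_rep (c : primeClass) : seq darc := val (repr c).

End Arcs.

Section Twisted.
Variables (R : realType) (G : sgraph) (theta : darc G -> R[i]).

Definition grover_entry (e f : darc G) : R[i] :=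
  if (tgt f == org e) && (f != inv_arc e) then
    2 * cexp (- ('i * theta e)) / (degree (tgt f))%:R
  else if f == inv_arc e then
    cexp (- ('i * theta e)) * (2 / (degree (tgt f))%:R - 1)
  else 0.

Definition grover_mx : 'M[R[i]]_#|{: darc G}| :=
  \matrix_(i, j) grover_entry (enum_val i) (enum_val j).

Definition twisted_zeta : fps R[i] :=
  (\det (1%:M - fpsX *: map_mx (@fpsC _) grover_mx))^-1.

Definition arc_weight (e f : darc G) : R[i] :=
  if (tgt e == org f) && (f != inv_arc e) then
    2 * cexp (- ('i * theta f)) / (degree (tgt e))%:R
  else if f == inv_arc e then
    cexp (- ('i * theta f)) * (2 / (degree (tgt e))%:R - 1)
  else 0.

(* zip C (rot 1 C) lists the pairs (e_1, e_2), ..., (e_r, e_1). *)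
Definition cycle_weight (C : seq (darc G)) : R[i] :=
  \prod_(p <- zip C (rot 1 C)) arc_weight p.1 p.2.

Lemma cycle_weight_rot i (C : seq (darc G)) :
  cycle_weight (rot i C) = cycle_weight C.
Proof.
rewrite /cycle_weight rot_rot.
have -> : zip (rot i C) (rot i (rot 1 C)) = rot i (zip C (rot 1 C)).
  rewrite {1 2 4}/rot zip_cat ?size_drop ?size_rot //.
  have zip_drop j (s t : seq (darc G)) :
      zip (drop j s) (drop j t) = drop j (zip s t).
    by elim: j s t => [|j IHj] [|x s] [|y t] //=; case: drop.
  have zip_take j (s t : seq (darc G)) :
      zip (take j s) (take j t) = take j (zip s t).
    by elim: j s t => [|j IHj] [|x s] [|y t] //=; rewrite IHj.
  by rewrite zip_drop zip_take.
by apply: perm_big; rewrite perm_rot.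
Qed.

Definition cycle_sum (k : nat) : R[i] :=
  \sum_(C : k.-tuple (darc G) | is_cycle C) cycle_weight C.

Definition cycle_sum_series : fps R[i] :=
  Fps (fun k => if k == 0%N then 0 else cycle_sum k / k%:R).

Definition euler_factor (c : primeClass G) : fps R[i] :=
  (1 - fpsC (cycle_weight (class_rep c)) * fpsX ^+ size (class_rep c))^-1.

End Twisted.

(* Main.v *)
Require Import Defs.
From HB Require Import structures.
From mathcomp Require Import all_boot all_order all_algebra.
From mathcomp Require Import generic_quotient finmap boolp reals sequences exp trigo.
From mathcomp.real_closed Require Import complex.

Set Implicit Arguments.
Unset Strict Implicit.
Unset Printing Implicit Defensive.

Import Order.TTheory GRing.Theory Num.Theory.
Local Open Scope ring_scope.
Local Arguments fps_coef : simpl never.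

(* Let N_k be the trace of the k-th power of the arc-weight matrix W, i.e. the
   weighted number of closed walks of length k.  All three series have constant
   term 1 and the same logarithmic derivative \sum_k N_k u^k for the derivation
   u d/du, which in characteristic 0 forces them to coincide:
   - for det(1 - uW)^-1 this is Jacobi's formula, the adjugate of 1 - uW being
     det(1 - uW) times \sum_k u^k W^k;
   - for the exponential it is immediate;
   - for the Euler product, every cycle of length k is in exactly one way
     a power of a rotation of a chosen representative of a prime class, so
     N_k = \sum_c |c| w(c)^(k/|c|), over the classes with |c| dividing k.
   The primitive root of a word comes from the size of its orbit under
   cyclic shift. *)

(** * Formal power series and the derivation [u d/du] *)

Section EulerDerivation.
Variable F : fieldType.
Implicit Types f g h : fps F.

(* The derivation u d/du, which preserves the order of a series. *)
Definition fps_theta f : fps F := Fps (fun n => n%:R * fps_coef f n).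

Lemma fps_coef_theta f n : fps_coef (fps_theta f) n = n%:R * fps_coef f n.
Proof. by []. Qed.

Lemma fps_theta_is_zmod_morphism : zmod_morphism fps_theta.
Proof. by move=> f g; apply: fpsP => n; exact: mulrBr. Qed.

HB.instance Definition _ :=
  GRing.isZmodMorphism.Build (fps F) (fps F) fps_theta
    fps_theta_is_zmod_morphism.

(** In each term of the Cauchy product the factor [n] splits as [i + (n - i)]. *)
Lemma fps_thetaM f g :
  fps_theta (f * g) = fps_theta f * g + f * fps_theta g.
Proof.
apply: fpsP => n; rewrite fps_coefD fps_coef_theta !fps_coefM.
rewrite mulr_sumr -big_split /=; apply: eq_bigr => i _.
rewrite !fps_coef_theta.
rewrite -mulrA [X in _ + X]mulrCA -mulrDl -natrD subnKC //.
by rewrite -ltnS.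
Qed.

Lemma fps_theta1 : fps_theta 1 = 0.
Proof.
by apply: fpsP => n; rewrite fps_coef_theta fps_coef1; case: n => [|n];
  rewrite ?mul0r ?mulr0.
Qed.

(** Logarithmic derivatives add over a finite product. Writing them as [E * L] avoids dividing by
    the factors. *)
Lemma fps_theta_prod (I : Type) (r : seq I) (E L : I -> fps F) :
    (forall i, fps_theta (E i) = E i * L i) ->
  fps_theta (\prod_(i <- r) E i) = \prod_(i <- r) E i * \sum_(i <- r) L i.
Proof.
move=> EL; elim: r => [|i r IHr]; first by rewrite !big_nil fps_theta1 mulr0.
rewrite !big_cons fps_thetaM IHr EL mulrDr mulrA [E i * L i * _]mulrAC.
by rewrite -!mulrA.
Qed.

Lemma fps_coefMn f m n : fps_coef (f *+ m) n = fps_coef f n *+ m.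
Proof. by elim: m => [|m IHm]; rewrite ?mulr0n // !mulrS fps_coefD IHm. Qed.

Lemma fps_thetaX f n : fps_theta (f ^+ n.+1) = f ^+ n * fps_theta f *+ n.+1.
Proof.
elim: n => [|n IHn]; first by rewrite expr0 mul1r.
rewrite exprS fps_thetaM IHn mulrnAr mulrA -exprS.
by rewrite [fps_theta f * _]mulrC -mulrS.
Qed.

(** Comes from differentiating [f^-1 * f = 1]. *)
Lemma fps_theta_inv f : fps_coef f 0 != 0 ->
  fps_theta f^-1 = - f^-1 * (f^-1 * fps_theta f).
Proof.
move=> f0; have Uf : f \is a GRing.unit by [].
apply: (mulrI Uf); rewrite mulNr mulrN mulVKr //.
apply/eqP; rewrite -addr_eq0 [f^-1 * _]mulrC addrC -fps_thetaM divrr //.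
by rewrite fps_theta1.
Qed.

Lemma fps_coef_exprXM l f n :
  fps_coef (fpsX ^+ l * f) n = if (l <= n)%N then fps_coef f (n - l) else 0.
Proof.
elim: l n => [|l IHl] n; first by rewrite mul1r subn0.
rewrite exprS -mulrA fps_coefM; case: n => [|n].
  by rewrite big_ord1 fps_coefX mul0r.
rewrite big_ord_recl big_ord_recl big1 /= => [|i _]; last by rewrite mul0r.
by rewrite mul0r add0r addr0 mul1r subn1 IHl subSS.
Qed.

Lemma fps_coef_exprX l n : fps_coef (fpsX ^+ l : fps F) n = (n == l)%:R.
Proof.
rewrite -[_ ^+ _]mulr1 fps_coef_exprXM fps_coef1 subn_eq0 eqn_leq.
by case: leqP; rewrite ?andbF ?andbT.
Qed.

Lemma fps_theta_geom (a : F) l :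
  fps_theta (1 - fpsC a * fpsX ^+ l) = - (fpsC (l%:R * a) * fpsX ^+ l).
Proof.
rewrite fps_theta_is_zmod_morphism fps_theta1 sub0r; congr (- _).
apply: fpsP => n; rewrite fps_coef_theta !fps_coefCM fps_coef_exprX.
by case: eqP => [->|]; rewrite ?mulrA ?mulr0.
Qed.

(** For [l > 0] this is the logarithmic derivative of $1/(1-au^l)$, namely
    $l\sum_{m\ge1}a^mu^{ml}$. *)
Definition geom_log_series (a : F) l : fps F :=
  Fps (fun n => if (0 < n)%N && (l %| n)%N then l%:R * a ^+ (n %/ l) else 0).

Lemma fps_coef0_geom (a : F) l : (0 < l)%N ->
  fps_coef (1 - fpsC a * fpsX ^+ l) 0 = 1.
Proof.
move=> l_gt0; rewrite fps_coefD fps_coefN fps_coef1 fps_coefCM fps_coef_exprX.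
by rewrite (ltn_eqF l_gt0) mulr0 subr0.
Qed.

(** Multiplying [geom_log_series a l] by $1-au^l$ telescopes to the single term $lau^l$. *)
Lemma fps_theta_inv_geom (a : F) l : (0 < l)%N ->
  fps_theta (1 - fpsC a * fpsX ^+ l)^-1 =
  (1 - fpsC a * fpsX ^+ l)^-1 * geom_log_series a l.
Proof.
move=> l_gt0; set f := 1 - _.
have f0 : fps_coef f 0 != 0 by rewrite fps_coef0_geom ?oner_eq0.
have Uf : f \is a GRing.unit by [].
rewrite fps_theta_inv // mulNr -mulrN; congr (_ * _).
apply: (mulrI Uf); rewrite mulrN mulVKr //.
rewrite fps_theta_geom opprK; apply: fpsP => n.
rewrite mulrBl mul1r fps_coefD fps_coefN -mulrA !fps_coefCM fps_coef_exprXM.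
rewrite fps_coef_exprX /fps_coef /=.
have [ltnl|leln] := ltnP n l.
  rewrite mulr0 subr0 ltn_eqF // mulr0; case: posnP => // n_gt0.
  by rewrite gtnNdvd.
rewrite -{1 2 3 4}(subnK leln); move: (n - l)%N => m.
have -> : ((m + l == l) = (m == 0))%N by rewrite -{2}[l]add0n eqn_add2r.
rewrite addn_gt0 l_gt0 orbT dvdn_addl //=.
case: posnP => [-> | m_gt0] /=.
  by rewrite dvdn0 add0n divnn l_gt0 mulr0 subr0 mulr1 expr1.
rewrite mulr0; case: ifP => l_dvd_m; last by rewrite mulr0 subr0.
by rewrite divnDr // divnn l_gt0 addn1 exprS mulrCA subrr.
Qed.

Lemma fps_coef_exp h n :
  fps_coef (fps_exp h) n = \sum_(j < n.+1) fps_coef (h ^+ j) n / j`!%:R.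
Proof. by []. Qed.

Lemma fps_theta_exp h : [pchar F] =i pred0 -> fps_coef h 0 = 0 ->
  fps_theta (fps_exp h) = fps_exp h * fps_theta h.
Proof.
move=> F0 h0; apply: fpsP => n.
have -> : fps_coef (fps_exp h * fps_theta h) n =
    \sum_(j < n.+1) fps_coef (h ^+ j * fps_theta h) n / j`!%:R.
  rewrite fps_coefM; under [RHS]eq_bigr do rewrite fps_coefM mulr_suml.
  rewrite exchange_big; apply: eq_bigr => i _ /=; rewrite fps_coef_exp.
  (* The coefficient of index [i] stops at [j = i]; the terms added up to [j = n] vanish because
     [h ^+ j] has order at least [j]. *)
  rewrite (big_ord_widen n.+1 (fun j => fps_coef (h ^+ j) i / j`!%:R)) //.
  rewrite big_mkcond mulr_suml /=; apply: eq_bigr => j _.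
  rewrite mulrAC; case: ltnP => [_|ltij]; first by rewrite mulrAC.
  by rewrite fps_coefX_small // !mul0r.
rewrite fps_coef_theta fps_coef_exp mulr_sumr big_ord_recl big_ord_recr /=.
(* The left sum loses its term [j = 0] and the right one its term [j = n], which is zero since
   [fps_theta h] has no constant term. The rest matches after a shift of [j] by one. *)
have -> : fps_coef (h ^+ n * fps_theta h) n = 0.
  rewrite fps_coefM big_ord_recr subnn /= fps_coef_theta mul0r mulr0 addr0.
  rewrite big1 // => i _.
  by rewrite fps_coefX_small // mul0r.
rewrite mul0r addr0 mulrA -fps_coef_theta fps_theta1 mul0r add0r.
apply: eq_bigr => j _; rewrite mulrA -fps_coef_theta fps_thetaX fps_coefMn.
rewrite -[fps_coef _ _ *+ _]mulr_natr -[bump 0 j]/(j.+1) factS natrM invfM.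
rewrite mulrA mulfK //.
by rewrite (pcharf0P _).1.
Qed.

(** The equation for [f] is the recurrence $kf_k=\sum_{i<k}f_ia_{k-i}$, which determines $f_k$ in
    characteristic 0. Only degrees up to [n] are compared, because a finite partial Euler product
    agrees with the zeta function only up to a given degree. *)
Lemma fps_eq_theta n f g a b : [pchar F] =i pred0 ->
    fps_coef a 0 = 0 -> (forall k, (k <= n)%N -> fps_coef a k = fps_coef b k) ->
    fps_coef f 0 = fps_coef g 0 ->
    fps_theta f = f * a -> fps_theta g = g * b ->
  forall k, (k <= n)%N -> fps_coef f k = fps_coef g k.
Proof.
move=> F0 a0 ab fg0 fa gb k; elim/ltn_ind: k => -[|k] IHk lekn //.
apply: (@mulfI _ k.+1%:R); first by rewrite (pcharf0P _).1.
rewrite -!fps_coef_theta fa gb !fps_coefM.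
rewrite big_ord_recr [in RHS]big_ord_recr /= subnn -(ab 0%N) // a0.
rewrite !mulr0 !addr0; apply: eq_bigr => i _.
have lein : (i <= n)%N by apply: ltnW; apply: leq_trans lekn.
by rewrite (IHk i (ltn_ord i) lein) ab // (leq_trans (leq_subr _ _)).
Qed.
End EulerDerivation.

(** * Jacobi's formula for a derivation of a commutative ring *)

Section Jacobi.
Variables (R : comNzRingType) (d : {additive R -> R}).
Hypothesis dM : forall x y, d (x * y) = d x * y + x * d y.

Lemma derivation_prod (I : eqType) (r : seq I) (x : I -> R) : uniq r ->
  d (\prod_(i <- r) x i) =
  \sum_(i <- r) \prod_(j <- r) (if j == i then d (x j) else x j).
Proof.
elim: r => [_|i r IHr /= /andP[ri Ur]].
  (* The empty product needs [d 1 = 0], which follows from [d (1 * 1) = d 1 + d 1]. *)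
  rewrite !big_nil; apply: (@addrI _ (d 1)).
  by rewrite addr0 -{3}[1]mulr1 dM mulr1 mul1r.
rewrite !big_cons dM eqxx IHr // mulr_sumr; congr (_ * _ + _).
  by apply: eq_big_seq => j rj; case: eqP => // ji; rewrite -ji rj in ri.
apply: eq_big_seq => k rk; rewrite big_cons.
by case: eqP => // ik; rewrite ik rk in ri.
Qed.

Lemma derivation_det n (M : 'M[R]_n) :
  d (\det M) = \sum_i \sum_j d (M i j) * cofactor M i j.
Proof.
(* [B i] is [M] with row [i] differentiated. Expanding along that row gives the cofactors of [M]
   itself, since they do not involve row [i]. *)
pose B i := \matrix_(k, j) (if k == i then d (M k j) else M k j).
have dsign (b : bool) x : d ((-1) ^+ b * x) = (-1) ^+ b * d x.
  by case: b; rewrite ?expr1 ?expr0 ?mul1r // !mulN1r raddfN.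
rewrite /determinant raddf_sum /=.
under eq_bigr do rewrite dsign derivation_prod ?index_enum_uniq // mulr_sumr.
rewrite exchange_big /=; apply: eq_bigr => i _.
transitivity (\det (B i)).
  apply: eq_bigr => s _; congr (_ * _); apply: eq_bigr => k _.
  by rewrite mxE.
rewrite (expand_det_row _ i); apply: eq_bigr => j _; rewrite mxE eqxx.
congr (_ * (_ * \det _)); apply/matrixP => k l; rewrite !mxE.
by rewrite eq_sym (negPf (neq_lift _ _)).
Qed.
End Jacobi.

(** * Constant terms and the series $\det(1-uW)$ *)

Lemma fps_coef_nat (F : fieldType) m k :
  fps_coef (m%:R : fps F) k = if k == 0%N then m%:R else 0.
Proof.
by rewrite fps_coefMn fps_coef1; case: eqP => //= _; rewrite mul0rn.
Qed.

(** Named so that it can be declared a ring morphism, which then passes through inverses, products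
    and determinants. *)
Definition fps_const (F : fieldType) (f : fps F) : F := fps_coef f 0.

Lemma fps_const_is_zmod_morphism (F : fieldType) :
  zmod_morphism (@fps_const F).
Proof. by []. Qed.

Lemma fps_const_is_monoid_morphism (F : fieldType) :
  monoid_morphism (@fps_const F).
Proof. by split=> // f g; rewrite /fps_const fps_coefM big_ord1. Qed.

HB.instance Definition _ (F : fieldType) :=
  GRing.isZmodMorphism.Build (fps F) F (@fps_const F)
    (@fps_const_is_zmod_morphism F).
HB.instance Definition _ (F : fieldType) :=
  GRing.isMonoidMorphism.Build (fps F) F (@fps_const F)
    (@fps_const_is_monoid_morphism F).

Lemma fps_coef0_inv (F : fieldType) (f : fps F) : fps_coef f 0 != 0 ->
  fps_coef f^-1 0 = (fps_coef f 0)^-1.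
Proof. by move=> f0; rewrite -[LHS]/(fps_const _) rmorphV. Qed.

Section CharacteristicSeries.
Variables (F : fieldType) (n : nat) (W : 'M[F]_n).

Let uW : 'M[fps F]_n := fpsX *: map_mx (@fpsC F) W.

Definition char_series : fps F := \det (1%:M - uW).

Definition trace_series : fps F :=
  Fps (fun k => if k == 0%N then 0 else \tr (W ^+ k)).

(** The Neumann series $\sum_k u^kW^k$, stored entrywise. *)
Definition resolvent_mx : 'M[fps F]_n :=
  \matrix_(i, j) Fps (fun k => (W ^+ k) i j).

Lemma fps_coef_mul_resolvent i j k :
  fps_coef ((uW *m resolvent_mx) i j) k =
  if k == 0%N then 0 else (W ^+ k) i j.
Proof.
rewrite mxE fps_coef_sum.
under eq_bigr do rewrite !mxE -mulrA -[fpsX]expr1 fps_coef_exprXM.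
case: k => [|k] /=; first by rewrite big1.
rewrite exprS mxE; apply: eq_bigr => l _.
by rewrite fps_coefCM subn1.
Qed.

(** Telescoping: [uW *m resolvent_mx] is the resolvent without its constant term. *)
Lemma mul_resolvent_mx : (1%:M - uW) *m resolvent_mx = 1%:M.
Proof.
rewrite mulmxBl mul1mx; apply/matrixP => i j; apply: fpsP => k.
rewrite [LHS](congr1 (fun f => fps_coef f k) (mxE _ _ i j)).
rewrite fps_coefD [X in _ + fps_coef X k]mxE fps_coefN fps_coef_mul_resolvent.
rewrite [resolvent_mx i j]mxE mxE fps_coef_nat /fps_coef.
by case: k => [|k]; rewrite ?subr0 ?subrr // expr0 mxE.
Qed.

Lemma fps_theta_char_series :
  fps_theta char_series = - (char_series * trace_series).
Proof.
rewrite /char_series; set M := 1%:M - uW.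
(* Obtained by inserting [M *m resolvent_mx = 1] to the right of the adjugate. *)
have adjM : \adj M = \det M *: resolvent_mx.
  by rewrite -[LHS]mulmx1 -mul_resolvent_mx mulmxA mul_adj_mx mul_scalar_mx.
(* The derivation kills constants and fixes multiples of [u]. *)
have dM : map_mx (@fps_theta F) M = - uW.
  apply/matrixP => i j; rewrite !mxE; apply: fpsP => k.
  rewrite fps_coef_theta fps_coefD !fps_coefN fps_coef_nat mulrDr mulrN.
  rewrite -[fpsX]expr1 fps_coef_exprXM fps_coefC subn_eq0.
  by case: k => [|[|k]]; rewrite /= ?mul0r ?mul1r ?mulr0 ?add0r ?oppr0.
have trS : \tr (uW *m resolvent_mx) = trace_series.
  apply: fpsP => k; rewrite fps_coef_sum.
  under eq_bigr do rewrite fps_coef_mul_resolvent.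
  by rewrite /trace_series /fps_coef; case: eqP => // _; rewrite big1.
rewrite (derivation_det (@fps_thetaM F)).
transitivity (\tr (map_mx (@fps_theta F) M *m \adj M)).
  apply: eq_bigr => i _; rewrite mxE; apply: eq_bigr => j _.
  by rewrite [\adj _ _ _]mxE [map_mx _ _ _ _]mxE.
by rewrite dM adjM mulNmx -scalemxAr raddfN /= mxtraceZ trS.
Qed.

Lemma fps_coef0_char_series : fps_coef char_series 0 = 1.
Proof.
rewrite -[LHS]/(fps_const _) -det_map_mx -[RHS](det1 F n); congr (\det _).
apply/matrixP => i j; rewrite !mxE /= /fps_const.
rewrite fps_coefD fps_coefN fps_coef_nat.
by rewrite -[fpsX]expr1 fps_coef_exprXM subr0.
Qed.
End CharacteristicSeries.

Lemma char_series_tr (F : fieldType) n (W : 'M[F]_n) :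
  char_series W^T = char_series W.
Proof.
rewrite /char_series -[RHS]det_tr; congr (\det _).
by apply/matrixP => i j; rewrite !mxE eq_sym.
Qed.

(** * Traces of matrix powers as sums over closed walks *)

Lemma big_tuple_cons (R : nmodType) (T : finType) k (E : k.+1.-tuple T -> R) :
  \sum_(t : k.+1.-tuple T) E t =
  \sum_x \sum_(s : k.-tuple T) E [tuple of x :: s].
Proof.
pose tcons (p : T * k.-tuple T) := [tuple of p.1 :: p.2].
pose tuncons (t : k.+1.-tuple T) := (thead t, [tuple of behead t]).
rewrite pair_big /= (reindex tcons) //=; exists tuncons => [[x s] _|t _].
  by congr pair; apply: val_inj.
by rewrite /tcons -tuple_eta.
Qed.

Section ClosedWalks.
Variables (F : fieldType) (T : finType) (w : T -> T -> F).

Definition weight_mx : 'M[F]_#|T| :=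
  \matrix_(i, j) w (enum_val i) (enum_val j).

(** The tuple [s] lists the interior points of a walk from [x] to [y], so [k] points give [k.+1]
    steps; the zip pairs consecutive points. *)
Lemma weight_mxX k x y :
  (weight_mx ^+ k.+1) (enum_rank x) (enum_rank y) =
  \sum_(s : k.-tuple T) \prod_(p <- zip (x :: s) (rcons s y)) w p.1 p.2.
Proof.
elim: k x => [|k IHk] x.
  rewrite expr1 mxE !enum_rankK (big_pred1 [tuple]) => [|s]; last first.
    by apply/esym/eqP/tuple0.
  by rewrite big_seq1.
rewrite exprS mxE big_tuple_cons (reindex (@enum_rank T)) /=; last first.
  by apply: onW_bij; apply: enum_rank_bij.
apply: eq_bigr => z _; rewrite IHk mulr_sumr mxE !enum_rankK.
by apply: eq_bigr => s _; rewrite big_cons.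
Qed.

Lemma trace_weight_mxX k :
  \tr (weight_mx ^+ k.+1) =
  \sum_(t : k.+1.-tuple T) \prod_(p <- zip t (rot 1 t)) w p.1 p.2.
Proof.
rewrite big_tuple_cons /mxtrace (reindex (@enum_rank T)) /=; last first.
  by apply: onW_bij; apply: enum_rank_bij.
apply: eq_bigr => x _; rewrite weight_mxX; apply: eq_bigr => s _.
by rewrite rot1_cons.
Qed.
End ClosedWalks.

(** The remainder of [p] modulo the orbit size is again a period, and [findex] separates exponents
    below the orbit size, so it is 0. *)
Lemma order_dvdn (T : finType) (f : T -> T) p x :
  injective f -> iter p f x = x -> (fingraph.order f x %| p)%N.
Proof.
move=> f_inj fpx; set o := fingraph.order f x.
have o_gt0 : (0 < o)%N by apply: order_gt0.
have fo m : iter (m * o) f x = x.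
  by elim: m => // m IHm; rewrite mulSn addnC iterD iter_order.
have lt_mod : (p %% o < o)%N by rewrite ltn_mod.
rewrite /dvdn -(findex_iter lt_mod) -{2}(fo (p %/ o)%N) -iterD addnC -divn_eq.
by rewrite fpx findex0.
Qed.

(** * Powers and rotations of words *)

Section WordPowers.
Variable T : eqType.
Implicit Types s u v : seq T.

(** [cycle_pow] over an arbitrary alphabet; the two are convertible on arcs. *)
Definition word_pow s l := flatten (nseq l s).

Lemma size_word_pow s l : size (word_pow s l) = (l * size s)%N.
Proof. by elim: l => //= l IHl; rewrite size_cat IHl mulSn. Qed.

Lemma word_powS s l : word_pow s l.+1 = s ++ word_pow s l.
Proof. by []. Qed.

Lemma word_powD s l m : word_pow s (l + m) = word_pow s l ++ word_pow s m.
Proof. by rewrite /word_pow nseqD flatten_cat. Qed.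

Lemma word_powM s l m : word_pow (word_pow s l) m = word_pow s (m * l).
Proof. by elim: m => //= m IHm; rewrite mulSn word_powD -IHm. Qed.

Lemma word_pow1 s : word_pow s 1 = s.
Proof. exact: cats0. Qed.

Lemma word_pow_cat_shift u v l :
  word_pow (u ++ v) l ++ u = u ++ word_pow (v ++ u) l.
Proof. by elim: l => [|l IHl]; rewrite ?cats0 // !word_powS -!catA IHl. Qed.

Lemma rot_word_pow i s l : (i <= size s)%N ->
  rot i (word_pow s l) = word_pow (rot i s) l.
Proof.
move=> le_is; case: l => // l; rewrite -{1}[s](cat_take_drop i) word_powS -catA.
have {1}-> : i = size (take i s) by rewrite size_takel.
by rewrite rot_size_cat -catA word_pow_cat_shift catA.
Qed.

Lemma rot_size_word_pow s l : rot (size s) (word_pow s l) = word_pow s l.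
Proof. by rewrite rot_word_pow // rot_size. Qed.

(** Rotating one letter at a time keeps each step within the bound required by [rot_word_pow]. *)
Lemma rot_word_pow_ex i s l : exists s', rot i (word_pow s l) = word_pow s' l.
Proof.
elim: i => [|i [s' IHi]]; first by exists s; rewrite rot0.
have [lt_i|le_i] := ltnP i (size (word_pow s l)); last first.
  by exists s; rewrite rot_oversize // ltnW.
exists (rot 1 s'); rewrite rotS // IHi; case: s' {IHi} => [|x s'].
  by rewrite /rot /=; elim: (l).
by rewrite rot_word_pow.
Qed.

Lemma take_word_pow s l m : (m <= l)%N ->
  take (m * size s) (word_pow s l) = word_pow s m.
Proof.
by move=> /subnKC <-; rewrite word_powD -size_word_pow take_size_cat.
Qed.

(** Commutation makes [u] a prefix of [v]; once it is stripped, the remainder still commutes with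
    [u]. *)
Lemma commuting_word_pow u v m :
  u ++ v = v ++ u -> size v = (m * size u)%N -> v = word_pow u m.
Proof.
elim: m v => [|m IHm] v uv szv; first exact: size0nil.
have defv : v = u ++ drop (size u) v.
  rewrite -{1}[v](cat_take_drop (size u)); congr (_ ++ _).
  have /(congr1 (take (size u))) := uv.
  by rewrite take_size_cat // takel_cat // szv mulSn leq_addr.
rewrite defv word_powS; congr (_ ++ _); apply: IHm.
  have := congr1 (drop (size u)) uv.
  by rewrite [in v ++ u]defv -catA !drop_size_cat // => <-.
by rewrite size_drop szv mulSn addKn.
Qed.

(** Invariance under [rot p] says that [take p s] and [drop p s] commute. *)
Lemma rot_fixed_word_pow p s : (p <= size s)%N -> (p %| size s)%N ->
  rot p s = s -> s = word_pow (take p s) (size s %/ p).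
Proof.
move=> le_ps p_dvd rot_s.
have [p0|p_gt0] := posnP p.
  by move: p_dvd; rewrite p0 dvd0n => /nilP ->.
have l_gt0 : (0 < size s %/ p)%N \/ s = [::].
  by case: s p_dvd {rot_s} le_ps => [|x s] *; [right|left; rewrite divn_gt0].
case: l_gt0 => [l_gt0|->]; last by rewrite div0n.
rewrite -(prednK l_gt0) word_powS -{1}[s](cat_take_drop p); congr (_ ++ _).
apply: commuting_word_pow; first by rewrite cat_take_drop.
by rewrite size_drop size_takel // -subn1 mulnBl divnK // mul1n.
Qed.

(** Unlike in [prime_cycle], the roots excluded here are arbitrary words; [prime_cycleP] reconciles
    the two notions. *)
Definition primitive_word s :=
  s != [::] /\ ~ exists u l, (2 <= l)%N /\ s = word_pow u l.

End WordPowers.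

(** * Primitive roots via orbits under cyclic shift *)

Section Roots.
Variable T : finType.
Implicit Types u v : seq T.

(** Fixing the length makes the shift a self-map of a finite type, so that its orbits have a
    size. *)
Definition rot1_tuple k (t : k.-tuple T) := [tuple of rot 1 t].

Lemma rot1_tuple_inj k : injective (@rot1_tuple k).
Proof. by move=> s t /(congr1 val) /rot_inj st; apply: val_inj. Qed.

Lemma iter_rot1_tuple k i (t : k.-tuple T) : (i <= k)%N ->
  val (iter i (@rot1_tuple k) t) = rot i t.
Proof.
elim: i => [|i IHi] lt_ik; first by rewrite rot0.
by rewrite iterS /= IHi ?(ltnW lt_ik) // -rotS ?size_tuple.
Qed.

Lemma order_rot1_dvdn k p (t : k.-tuple T) : (p <= k)%N -> rot p t = t ->
  (fingraph.order (@rot1_tuple k) t %| p)%N.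
Proof.
move=> le_pk rot_t; apply: order_dvdn; first exact: rot1_tuple_inj.
by apply: val_inj; rewrite iter_rot1_tuple.
Qed.

Lemma order_rot1_dvd_size k (t : k.-tuple T) :
  (fingraph.order (@rot1_tuple k) t %| k)%N.
Proof. by apply: order_rot1_dvdn; rewrite // -{1}(size_tuple t) rot_size. Qed.

Lemma word_pow_root k (t : k.-tuple T) (p := fingraph.order (@rot1_tuple k) t) :
  (0 < k)%N -> val t = word_pow (take p t) (k %/ p).
Proof.
move=> k_gt0; have p_dvd : (p %| k)%N := order_rot1_dvd_size t.
have := @rot_fixed_word_pow _ p t; rewrite size_tuple; apply=> //.
  exact: dvdn_leq.
rewrite -(iter_rot1_tuple t (dvdn_leq k_gt0 p_dvd)).
by rewrite (iter_order (@rot1_tuple_inj k)).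
Qed.

(** The orbit size [p] divides [size u], and then [u] is a power of the prefix of length [p];
    primitivity forces the exponent to be 1. *)
Lemma order_rot1_word_pow k (t : k.-tuple T) u l : (0 < k)%N ->
  primitive_word u -> val t = word_pow u l ->
  fingraph.order (@rot1_tuple k) t = size u.
Proof.
move=> k_gt0 [u_neq0 u_prim] tE; set p := fingraph.order _ t.
have kE : k = (l * size u)%N by rewrite -(size_tuple t) tE size_word_pow.
have l_gt0 : (0 < l)%N by move: k_gt0; rewrite kE muln_gt0 => /andP[].
have le_uk : (size u <= k)%N by rewrite kE leq_pmull.
have p_dvd : (p %| size u)%N.
  by apply: order_rot1_dvdn; rewrite // tE rot_size_word_pow.
have p_gt0 : (0 < p)%N by apply: order_gt0.
have uE : u = word_pow (take p t) (size u %/ p).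
  have -> : u = take (size u) t.
    by rewrite tE -{1}[size u]mul1n take_word_pow // word_pow1.
  rewrite size_takel ?size_tuple // {1}(word_pow_root t k_gt0) -/p.
  rewrite -{1}(divnK p_dvd); have {2}-> : p = size (take p t).
    rewrite size_takel // size_tuple (leq_trans _ le_uk) // dvdn_leq //.
    by rewrite lt0n size_eq0.
  by rewrite take_word_pow // leq_div2r.
case: (ltngtP (size u %/ p) 1) => [|lt1|/(congr1 (muln^~ p))].
- by rewrite ltnNge divn_gt0 // dvdn_leq // lt0n size_eq0.
- by case: u_prim; exists (take p t), (size u %/ p)%N.
- by rewrite divnK // mul1n.
Qed.

Lemma primitive_root_ex u : u != [::] ->
  exists v l, primitive_word v /\ u = word_pow v l.
Proof.
rewrite -size_eq0 -lt0n => k_gt0; pose t := in_tuple u.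
set k := size u in k_gt0 t; pose p := fingraph.order (@rot1_tuple k) t.
have p_gt0 : (0 < p)%N by apply: order_gt0.
have le_pk : (p <= k)%N by apply/dvdn_leq/order_rot1_dvd_size.
have uE : u = word_pow (take p u) (k %/ p) := word_pow_root t k_gt0.
exists (take p u), (k %/ p)%N; split=> //.
have szv : size (take p u) = p by rewrite size_takel.
split; first by rewrite -size_eq0 szv -lt0n.
case=> x [m [m_gt1 vE]]; have pE : p = (m * size x)%N.
  by rewrite -size_word_pow -vE szv.
have x_gt0 : (0 < size x)%N by move: p_gt0; rewrite pE muln_gt0 => /andP[].
have lt_xp : (size x < p)%N by rewrite pE ltn_Pmull.
(* If the prefix were a proper power of [x], then [u] would be a power of [x] too, hence fixed by a
   rotation shorter than its orbit size. *)
suff /dvdn_leq : (p %| size x)%N by move=> /(_ x_gt0); rewrite leqNgt lt_xp.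
apply: order_rot1_dvdn; first exact: ltnW (leq_trans lt_xp le_pk).
by rewrite /= uE vE word_powM rot_size_word_pow.
Qed.

(** Both roots are prefixes of the same word, of length its orbit size. *)
Lemma primitive_root_uniq u v l m : primitive_word u -> primitive_word v ->
  (0 < l)%N -> word_pow u l = word_pow v m -> u = v.
Proof.
move=> prim_u prim_v l_gt0 uv.
have u_gt0 : (0 < size u)%N by case: prim_u; rewrite -size_eq0 -lt0n.
pose t := in_tuple (word_pow u l).
have k_gt0 : (0 < size (word_pow u l))%N.
  by rewrite size_word_pow muln_gt0 l_gt0.
have m_gt0 : (0 < m)%N.
  by move: k_gt0; rewrite uv size_word_pow muln_gt0 => /andP[].
have takeE (w : seq T) n : (0 < n)%N -> w = take (size w) (word_pow w n).
  by move=> n_gt0; rewrite -[size w]mul1n take_word_pow // word_pow1.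
rewrite [LHS](takeE u l) // [RHS](takeE v m) // -uv.
rewrite -(order_rot1_word_pow (t := t) k_gt0 prim_u erefl).
by rewrite -(order_rot1_word_pow (t := t) k_gt0 prim_v uv).
Qed.

Lemma primitive_rot_inj u i j : primitive_word u ->
  (i < size u)%N -> (j < size u)%N -> rot i u = rot j u -> i = j.
Proof.
move=> prim_u lt_iu lt_ju rot_ij; pose t := in_tuple u.
have o_t : fingraph.order (@rot1_tuple (size u)) t = size u.
  apply: (@order_rot1_word_pow _ _ _ 1); rewrite ?word_pow1 //.
  exact: leq_ltn_trans lt_iu.
rewrite -o_t in lt_iu lt_ju; rewrite -(findex_iter lt_iu) -(findex_iter lt_ju).
rewrite o_t in lt_iu lt_ju.
by congr findex; apply: val_inj; rewrite !iter_rot1_tuple // ltnW.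
Qed.

Lemma primitive_rot u i : primitive_word u -> primitive_word (rot i u).
Proof.
case=> u_neq0 prim_u; split; first by rewrite -size_eq0 size_rot size_eq0.
case=> v [l [l_gt1 rotE]]; case: prim_u.
have [v' v'E] := rot_word_pow_ex (size u - i) v l.
by exists v', l; rewrite -v'E -rotE -(size_rot i u) -/(rotr i (rot i u)) rotK.
Qed.
End Roots.

(** * Prime cycles, their classes, and the unique root of a cycle *)

Section PrimeCycles.
Variable G : sgraph.
Implicit Types (C B : seq (darc G)) (c : primeClass G).

Lemma is_cycle_pow C l : (0 < l)%N -> is_cycle (cycle_pow C l) = is_cycle C.
Proof.
case: C l => [|x s] [|l] // _; first by rewrite /is_cycle /cycle_pow; elim: l.
rewrite /is_cycle /cycle_pow /=; elim: l => [|l IHl]; first by rewrite cats0.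
by rewrite /= rcons_cat rcons_cons -cat_rcons cat_path last_rcons IHl andbb.
Qed.

Lemma is_cycle_rot i C : is_cycle (rot i C) = is_cycle C.
Proof. by rewrite /is_cycle rot_cycle -!size_eq0 size_rot. Qed.

(** Any root of a cycle is itself a cycle, by [is_cycle_pow]. *)
Lemma prime_cycleP C : prime_cycle C <-> is_cycle C /\ primitive_word C.
Proof.
split=> [[cycC primeC] | [cycC [_ primC]]]; split=> //.
  split; first by case/andP: cycC.
  case=> u [l [l_gt1 CE]]; case: primeC; exists u, l; split=> //.
  by move: cycC; rewrite CE -(is_cycle_pow u (ltnW l_gt1)).
by case=> B [l [_ l_gt1 CE]]; apply: primC; exists B, l.
Qed.

Lemma class_repP c : is_cycle (class_rep c) /\ primitive_word (class_rep c).
Proof. by apply/prime_cycleP/asboolP; apply: (valP (repr c)). Qed.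

Lemma class_rep_gt0 c : (0 < size (class_rep c))%N.
Proof. by case: (class_repP c) => _ [+ _]; rewrite -size_eq0 -lt0n. Qed.

Lemma prime_cycle_class C : prime_cycle C ->
  exists c i, (i < size (class_rep c))%N /\ C = rot i (class_rep c).
Proof.
move=> /asboolP pC; pose C' : primeCycle G := exist _ C pC.
pose c := (\pi_(primeClass G) C')%qT.
have /asboolP[i /= CE] : cycle_equiv (repr c) C'.
  by apply/eqmodP; rewrite reprK.
exists c; have [lt_i|le_i] := ltnP i (size (class_rep c)); first by exists i.
by exists 0%N; rewrite class_rep_gt0 CE rot0 rot_oversize.
Qed.

Lemma class_rep_rot_inj c c' i j :
  rot i (class_rep c) = rot j (class_rep c') -> c = c'.
Proof.
move=> rot_ij; rewrite -[c]reprK -[c']reprK; apply/eqmodP/asboolP.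
exists (rot_add (class_rep c) i (size (class_rep c') - j)).
rewrite -rot_rot_add // rot_ij -(size_rot j (class_rep c')).
by rewrite -/(rotr _ _) rotK.
Qed.

(* A cycle is a power of exactly one rotation of one class representative. *)
Lemma count_primitive_root (F : fieldType) k (t : k.-tuple (darc G))
    (S : seq (primeClass G)) :
    (0 < k)%N -> uniq S ->
    (forall c, (size (class_rep c) <= k)%N -> c \in S) ->
  \sum_(c <- S | (size (class_rep c) %| k)%N)
    \sum_(i < size (class_rep c))
       (val t == cycle_pow (rot i (class_rep c)) (k %/ size (class_rep c)))%:R
  = (is_cycle t)%:R :> F.
Proof.
move=> k_gt0 uniqS inS; have [cyc_t|ncyc_t] := boolP (is_cycle t); last first.
  rewrite big1 // => c c_dvd; rewrite big1 // => i _; case: eqP => // tE.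
  case/negP: ncyc_t; rewrite tE is_cycle_pow.
    by rewrite is_cycle_rot; case: (class_repP c).
  by rewrite divn_gt0 ?class_rep_gt0 // dvdn_leq.
have [u [l [prim_u tE]]] : exists u l, primitive_word u /\ val t = word_pow u l.
  by apply: primitive_root_ex; case/andP: cyc_t.
have szt : (l * size u)%N = k by rewrite -size_word_pow -tE size_tuple.
have l_gt0 : (0 < l)%N by move: k_gt0; rewrite -szt muln_gt0 => /andP[].
have [c [i [lt_i uE]]] : exists c i,
    (i < size (class_rep c))%N /\ u = rot i (class_rep c).
  apply: prime_cycle_class; apply/prime_cycleP; split=> //.
  by move: cyc_t; rewrite tE -(is_cycle_pow u l_gt0).
have szu : size u = size (class_rep c) by rewrite uE size_rot.
have c_dvd : (size (class_rep c) %| k)%N by rewrite -szt szu dvdn_mull.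
have lE : (k %/ size (class_rep c))%N = l.
  by rewrite -szt szu mulnK ?class_rep_gt0.
have cS : c \in S by apply: inS; apply: dvdn_leq.
(* Uniqueness of the primitive root leaves only the class [c]; [primitive_rot_inj] then leaves only
   the rotation [i]. *)
have u_uniq c' j : (size (class_rep c') %| k)%N ->
    val t = cycle_pow (rot j (class_rep c')) (k %/ size (class_rep c')) ->
  u = rot j (class_rep c').
  move=> c'_dvd tE'; apply: (primitive_root_uniq prim_u _ l_gt0).
    by apply: primitive_rot; case: (class_repP c').
  exact: etrans (esym tE) tE'.
rewrite big_mkcond (bigD1_seq c) //= c_dvd.
rewrite [X in _ + X]big1 => [|c' c'_neq]; last first.
  case: ifP => // c'_dvd; rewrite big1 // => j _.
  case: eqP => // /(u_uniq _ _ c'_dvd); rewrite uE => /class_rep_rot_inj cE.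
  by rewrite cE eqxx in c'_neq.
rewrite addr0 (bigD1 (Ordinal lt_i)) //= lE -uE -[cycle_pow _ _]/(word_pow u l).
rewrite -tE eqxx big1 ?addr0 // => j j_neq; case: eqP => // tE'.
case/eqP: j_neq; apply: val_inj => /=.
apply: (@primitive_rot_inj _ (class_rep c)) => //.
  by case: (class_repP c).
by rewrite -uE; apply/esym/u_uniq; rewrite // lE.
Qed.

(** There are finitely many words of bounded length over the arcs, and each class is the image of
    its representative. *)
Lemma finite_short_classes n : exists S0 : {fset primeClass G},
  forall c, (size (class_rep c) <= n)%N -> c \in S0.
Proof.
pose words := flatten [seq [seq val t | t <- enum {: l.-tuple (darc G)}]
                      | l <- iota 0 n.+1].
pose class_of (C : seq (darc G)) : option (primeClass G) :=
  omap (fun C' : primeCycle G => \pi_(primeClass G) C')%qT (insub C).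
exists [fset c in pmap class_of words]%fset => c le_cn; rewrite inE mem_pmap.
apply/mapP; exists (class_rep c); last by rewrite /class_of valK /= reprK.
apply/flattenP; eexists.
  by apply: map_f; rewrite mem_iota; apply: le_cn.
by apply/mapP; exists (in_tuple (class_rep c)); rewrite ?mem_enum.
Qed.

End PrimeCycles.

(** * The weights of the graph and the three series *)

Section Zeta.
Variables (R : realType) (G : sgraph) (theta : darc G -> R[i]).
Implicit Types (C : seq (darc G)) (c : primeClass G).

Lemma inv_arcK : involutive (@inv_arc G).
Proof. by move=> e; apply: val_inj; rewrite /= -surjective_pairing. Qed.

(** The Grover matrix is thus the transpose of the weight matrix, and [char_series_tr] absorbs the
    difference. *)
Lemma grover_entryE e f : grover_entry theta e f = arc_weight theta f e.
Proof.
have fe : (f == inv_arc e) = (e == inv_arc f).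
  by rewrite -(can_eq inv_arcK) inv_arcK eq_sym.
by rewrite /grover_entry /arc_weight fe.
Qed.

Lemma arc_weight_eq0 e f : tgt e != org f -> arc_weight theta e f = 0.
Proof.
rewrite /arc_weight => /negPf ef; rewrite ef /=.
by case: eqP => // fE; rewrite fE eqxx in ef.
Qed.

Lemma path_weight_eq0 e s f :
    ~~ path (fun e f => tgt e == org f) e (rcons s f) ->
  \prod_(p <- zip (e :: s) (rcons s f)) arc_weight theta p.1 p.2 = 0.
Proof.
elim: s e => [|g s IHs] e /=; rewrite big_cons /=.
  by rewrite andbT => /arc_weight_eq0 ->; rewrite mul0r.
rewrite negb_and => /orP[/arc_weight_eq0 -> | /IHs ->]; first by rewrite mul0r.
by rewrite mulr0.
Qed.

(** Lets the sum over cycles run over all tuples, as the trace formula requires. *)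
Lemma cycle_weight_eq0 C :
  C != [::] -> ~~ is_cycle C -> cycle_weight theta C = 0.
Proof.
case: C => // e s _; rewrite /is_cycle /= => /path_weight_eq0.
by rewrite /cycle_weight rot1_cons.
Qed.

Lemma cycle_weight_pow C l :
  cycle_weight theta (cycle_pow C l) = cycle_weight theta C ^+ l.
Proof.
rewrite /cycle_weight.
case: C => [|e s].
  have -> : cycle_pow [::] l = [::] :> seq (darc G).
    by rewrite /cycle_pow; elim: l.
  by rewrite /= !big_nil expr1n.
have -> : rot 1 (cycle_pow (e :: s) l) = cycle_pow (rot 1 (e :: s)) l.
  by apply: rot_word_pow.
elim: l => [|l IHl]; first by rewrite big_nil.
have powS C : cycle_pow C l.+1 = C ++ cycle_pow C l by [].
by rewrite !powS zip_cat ?size_rot // big_cat exprS IHl.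
Qed.

Lemma cycle_sum_trace k :
  cycle_sum theta k.+1 = \tr (weight_mx (arc_weight theta) ^+ k.+1).
Proof.
rewrite trace_weight_mxX /cycle_sum big_mkcond; apply: eq_bigr => t _.
case: ifPn => // ncyc_t; rewrite -[RHS]/(cycle_weight theta t).
by rewrite cycle_weight_eq0 // -size_eq0 size_tuple.
Qed.

Lemma cycle_sum_classes k (S : seq (primeClass G)) :
    (0 < k)%N -> uniq S ->
    (forall c, (size (class_rep c) <= k)%N -> c \in S) ->
  \sum_(c <- S) fps_coef (geom_log_series (cycle_weight theta (class_rep c))
                             (size (class_rep c))) k =
  cycle_sum theta k.
Proof.
move=> k_gt0 uniqS inS; rewrite /cycle_sum [RHS]big_mkcond /=.
transitivity (\sum_(t : k.-tuple (darc G))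
    (is_cycle t)%:R * cycle_weight theta t); last first.
  by apply: eq_bigr => t _; case: ifP; rewrite ?mul1r ?mul0r.
(* The cycle indicator is replaced by the count of pairs of a class and a rotation. After exchanging
   sums, each pair selects one tuple, and the [size (class_rep c)] rotations of a class have equal
   weight. *)
under [RHS]eq_bigr do
  rewrite -(count_primitive_root _ _ k_gt0 uniqS inS) mulr_suml.
rewrite exchange_big [RHS]big_mkcond /=; apply: eq_bigr => c _.
rewrite /fps_coef /= k_gt0 /=; case: ifP => //= c_dvd.
under [RHS]eq_bigr do rewrite mulr_suml.
rewrite exchange_big /= mulr_natl -[in LHS](card_ord (size (class_rep c))).
rewrite -sumr_const; apply: eq_bigr => i _.
set C := cycle_pow _ _.
have szC : size C == k.
  by rewrite [size C]size_word_pow size_rot divnK.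
rewrite (bigD1 (Tuple szC)) //= eqxx mul1r big1 => [|t t_neq]; last first.
  case: eqP => [tC|_]; last by rewrite mul0r.
  by case/eqP: t_neq; apply: val_inj.
by rewrite addr0 cycle_weight_pow cycle_weight_rot card_ord.
Qed.

Lemma twisted_zetaE :
  twisted_zeta theta = (char_series (weight_mx (arc_weight theta)))^-1.
Proof.
have groverE : grover_mx theta = (weight_mx (arc_weight theta))^T.
  by apply/matrixP => i j; rewrite !mxE grover_entryE.
rewrite -[twisted_zeta theta]/((char_series (grover_mx theta))^-1).
by rewrite groverE char_series_tr.
Qed.

Lemma fps_theta_twisted_zeta :
  fps_theta (twisted_zeta theta) =
  twisted_zeta theta * trace_series (weight_mx (arc_weight theta)).
Proof.
rewrite twisted_zetaE; set f := char_series _.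
have f0 : fps_coef f 0 != 0 by rewrite fps_coef0_char_series oner_eq0.
have Uf : f \is a GRing.unit by [].
by rewrite fps_theta_inv // fps_theta_char_series -/f mulrN mulKr // mulrNN.
Qed.

Lemma trace_series_cycle_sum :
  trace_series (weight_mx (arc_weight theta)) =
  fps_theta (cycle_sum_series theta).
Proof.
apply: fpsP => -[|k]; rewrite fps_coef_theta /fps_coef /= ?mul0r //.
by rewrite -cycle_sum_trace mulrC divfK // pnatr_eq0.
Qed.

Lemma fps_coef0_euler_factor c : fps_coef (euler_factor theta c) 0 = 1.
Proof.
have rep_gt0 := class_rep_gt0 c.
by rewrite fps_coef0_inv fps_coef0_geom ?invr1 ?oner_eq0.
Qed.

End Zeta.

Theorem theorem10 (R : realType) (G : sgraph) (A : {set G * G})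
    (theta : darc G -> R[i])
    (Gconn : connected_graph G)
    (A_arcs : A :|: rev_arcs A = arcs G)
    (theta_inv : forall e : darc G, val e \in A ->
       theta (inv_arc e) = - theta e)
    (theta_bi : forall e : darc G, val e \in A :&: rev_arcs A ->
       theta e = 0) :
  fps_is_prod (euler_factor theta) (twisted_zeta theta) /\
  twisted_zeta theta = fps_exp (cycle_sum_series theta).
Proof.
have F0 : [pchar R[i]] =i pred0 := Num.Theory.pchar_num _.
have zeta0 : fps_coef (twisted_zeta theta) 0 = 1.
  by rewrite twisted_zetaE fps_coef0_inv fps_coef0_char_series ?invr1 ?oner_eq0.
split; last first.
  apply: fpsP => n; apply: (fps_eq_theta F0 _ _ _ (fps_theta_twisted_zeta theta)
    (fps_theta_exp F0 _)) (leqnn n) => //.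
  - by move=> k _; rewrite trace_series_cycle_sum.
  - by rewrite zeta0 fps_coef_exp big_ord1 expr0 fps_coef1 divr1.
move=> n; have [S0 inS0] := finite_short_classes G n.
(* [S0] contains every class of length at most [n]. Longer classes in [S] do not affect the
   logarithmic derivative in these degrees. *)
exists S0 => S /fsubsetP S0S.
pose L (c : primeClass G) := geom_log_series (cycle_weight theta (class_rep c))
  (size (class_rep c)).
have EL c : fps_theta (euler_factor theta c) = euler_factor theta c * L c.
  by apply: fps_theta_inv_geom; apply: class_rep_gt0.
apply/esym; apply: (fps_eq_theta F0 _ _ _ (fps_theta_twisted_zeta theta)
  (fps_theta_prod S EL)) (leqnn n) => //.
- move=> [|k] le_kn; rewrite fps_coef_sum.
    by rewrite big1.
  rewrite (cycle_sum_classes theta (ltn0Sn k) (fset_uniq S)) => [|c le_ck].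
    by rewrite cycle_sum_trace.
  exact/S0S/inS0/(leq_trans le_ck).
- rewrite zeta0 -[RHS]/(fps_const _) rmorph_prod big1 // => c _.
  exact: fps_coef0_euler_factor.
Qed.
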